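(* Let $G$ be a connected graph and let $m=\min\{\alpha(\widehat{G}),\ \beta(\widehat{G})-\beta^*(G)+1\}$. There exists a number $k(G)\in\mathbb{N}$ with $\alpha(\widehat{G})+\beta^*(G)\le k(G)\le \mathrm{n}(G)$ such that $\xi(G\odot H)=\beta(\widehat{G})\,\mathrm{n}(H)+k(G)$ for every graph $H$ with $\mathrm{n}(H)>m$, and $\xi(G\odot H)\le \beta(\widehat{G})\,\mathrm{n}(H)+k(G)$ for every graph $H$ with $\mathrm{n}(H)\le m$.
   Context: All graphs are finite, simple and undirected; $\mathrm{n}(H)$ denotes the order of $H$. For a connected graph $\Gamma$, a set $S\subseteq V(\Gamma)$ is a distance-equalizer set if for every two distinct $u,v\in V(\Gamma)\setminus S$ there is $w\in S$ with $d_\Gamma(w,u)=d_\Gamma(w,v)$; $\xi(\Gamma)$ is the minimum cardinality of a distance-equalizer set of $\Gamma$. For $V(G)=\{v_1,\dots,v_n\}$, the corona product $G\odot H$ is obtained from $G$ and $n$ pairwise disjoint copies $H_1,\dots,H_n$ of $H$ by joining $v_i$ to every vertex of $H_i$. The empty bisector graph $\widehat{G}$ has vertex set $V(G)$, with distinct $u,v$ adjacent iff there is no $w\in V(G)$ with $d_G(w,u)=d_G(w,v)$. $\alpha$ denotes the independence number and $\beta$ the vertex cover number. A pair $(X,Y)$ of subsets of $V(G)$ with $X\cup Y=V(G)$ is a forward-equalized pair of $G$ if for every $(u,v)\in (X\setminus Y)\times(Y\setminus X)$ there exists $w\in V(G)$ with $d_G(w,u)=d_G(w,v)+1$. $\beta^*(G)=\min\{|X\cap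 Y| : X,Y \text{ vertex covers of } \widehat{G},\ (X,Y) \text{ a forward-equalized pair of } G\}$. *)

(* Defs.v *)
From HB Require Import structures.
From mathcomp Require Import all_boot.

Set Implicit Arguments.
Unset Strict Implicit.
Unset Printing Implicit Defensive.

(* Graphs are nonempty, as is standard; this matters for the second factor of
   a corona product. *)
Record sgraph := SGraph {
  vertex :> finType;
  adj : rel vertex;
  adj_sym : symmetric adj;
  adj_irr : irreflexive adj;
  vertex_gt0 : 0 < #|vertex|
}.

Definition graph_order (G : sgraph) : nat := #|G|.

Definition connected (G : sgraph) : Prop := forall x y : G, connect (@adj G) x y.

(* [path adj x p] is a walk x :: p with [size p] edges.  A shortest walk between
   two connected vertices has fewer than #|G| edges; the value for disconnected
   vertices is the junk value #|G|. *)
Definition dist (G : sgraph) (x y : G) : nat :=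
  find (fun k => [exists p : k.-tuple G, path (@adj G) x p && (last x p == y)])
       (iota 0 #|G|).

Lemma dist_min (G : sgraph) (x y : G) (p : seq G) :
  path (@adj G) x p -> last x p = y -> dist x y <= size p.
Proof.
move=> xp lp; rewrite leqNgt; apply/negP => lt_p.
have lt_pn : size p < #|G|.
  by apply: leq_trans lt_p _; rewrite -[X in _ <= X](size_iota 0); apply: find_size.
have := before_find 0 lt_p; rewrite nth_iota // add0n => /existsP[].
by exists (in_tuple p); rewrite xp lp eqxx.
Qed.

Lemma dist_walk (G : sgraph) (x y : G) : connect (@adj G) x y ->
  exists p, [/\ path (@adj G) x p, last x p = y & size p = dist x y].
Proof.
case/connectP => p0 /shortenP[p xp up _] lp.
have lt_pn : size p < #|G|.
  by apply: leq_trans (max_card (mem (x :: p))); rewrite (card_uniqP up).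
have lt_d : dist x y < #|G| by apply: leq_ltn_trans lt_pn; apply: dist_min.
have := lt_d; rewrite -[X in _ < X](size_iota 0) -has_find => /(nth_find 0).
rewrite -/(dist x y) nth_iota // add0n => /existsP[t /andP[xt /eqP lt]].
by exists t; split; rewrite ?size_tuple.
Qed.

Definition equalizer_set (G : sgraph) (S : {set G}) : bool :=
  [forall u : G, forall v : G,
    [&& u != v, u \notin S & v \notin S] ==>
    [exists w in S, dist w u == dist w v]].

Definition xi (G : sgraph) : nat :=
  #|[arg min_(S < [set: G] | equalizer_set S) #|S| ]|.

Section Corona.
Variables G H : sgraph.

(* [inl g] is the vertex g of G, [inr (g, h)] is the vertex h of the copy of H
   attached to g. *)
Definition corona_adj : rel (G + G * H) := fun x y =>
  match x, y with
  | inl a, inl b => adj a b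
  | inl a, inr (b, _) => a == b
  | inr (a, _), inl b => a == b
  | inr (a, h), inr (b, h') => (a == b) && adj h h'
  end.

Lemma corona_adj_sym : symmetric corona_adj.
Proof.
case=> [a|[a h]] [b|[b h']] //=; first exact: adj_sym.
  by rewrite eq_sym adj_sym.
Qed.

Lemma corona_adj_irr : irreflexive corona_adj.
Proof. by case=> [a|[a h]] /=; rewrite adj_irr ?andbF. Qed.

Lemma corona_gt0 : 0 < #|{: G + G * H}|.
Proof. by rewrite card_sum addn_gt0 vertex_gt0. Qed.

Definition corona : sgraph := SGraph corona_adj_sym corona_adj_irr corona_gt0.

End Corona.

Section EmptyBisector.
Variable G : sgraph.

Definition ebis_adj : rel G := fun u v =>
  (u != v) && ~~ [exists w : G, dist w u == dist w v].

Lemma ebis_adj_sym : symmetric ebis_adj.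
Proof.
move=> u v; rewrite /ebis_adj eq_sym; congr (_ && ~~ _).
by apply: eq_existsb => w; rewrite eq_sym.
Qed.

Lemma ebis_adj_irr : irreflexive ebis_adj.
Proof. by move=> u; rewrite /ebis_adj eqxx. Qed.

Definition empty_bisector_graph : sgraph :=
  SGraph ebis_adj_sym ebis_adj_irr (vertex_gt0 G).

End EmptyBisector.

Definition independent (G : sgraph) (S : {set G}) : bool :=
  [forall u in S, forall v in S, ~~ adj u v].

Definition alpha (G : sgraph) : nat :=
  \max_(S : {set G} | independent S) #|S|.

Definition vertex_cover (G : sgraph) (S : {set G}) : bool :=
  [forall u : G, forall v : G, adj u v ==> (u \in S) || (v \in S)].

Definition beta (G : sgraph) : nat :=
  #|[arg min_(S < [set: G] | vertex_cover S) #|S| ]|.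

Definition forward_equalized (G : sgraph) (X Y : {set G}) : bool :=
  (X :|: Y == [set: G]) &&
  [forall u in X :\: Y, forall v in Y :\: X,
    exists w : G, dist w u == dist w v + 1].

Definition beta_star_pair (G : sgraph) (XY : {set G} * {set G}) : bool :=
  [&& @vertex_cover (empty_bisector_graph G) XY.1,
      @vertex_cover (empty_bisector_graph G) XY.2
    & forward_equalized XY.1 XY.2].

(* The full pair ([set: G], [set: G]) is admissible, so the minimum is over a
   nonempty family. *)
Definition beta_star (G : sgraph) : nat :=
  let XY := [arg min_(XY < ([set: G], [set: G]) | beta_star_pair XY)
               #|XY.1 :&: XY.2| ] in
  #|XY.1 :&: XY.2|.

Lemma vertex_coverT (G : sgraph) : vertex_cover [set: G].
Proof. by apply/forallP=> u; apply/forallP=> v; rewrite !inE implybT. Qed.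

Lemma equalizer_setT (G : sgraph) : equalizer_set [set: G].
Proof. by apply/forallP=> u; apply/forallP=> v; rewrite !inE andbF. Qed.

Lemma beta_star_pairT (G : sgraph) (Y : {set G}) :
  @vertex_cover (empty_bisector_graph G) Y -> beta_star_pair ([set: G], Y).
Proof.
move=> covY; apply/and3P; split=> //=; first exact: vertex_coverT.
rewrite /forward_equalized setTU eqxx /=.
apply/forallP=> u; apply/implyP=> _; apply/forallP=> v.
by rewrite !inE.
Qed.

(* Hence the subtraction beta - beta_star in nat is never truncated. *)
Lemma beta_star_le_beta (G : sgraph) :
  beta_star G <= beta (empty_bisector_graph G).
Proof.
rewrite /beta; case: arg_minnP => [|S covS _]; first exact: vertex_coverT.
rewrite /beta_star; case: arg_minnP => [|XY _ minXY].
  by apply: beta_star_pairT; exact: vertex_coverT.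
by have := minXY _ (beta_star_pairT covS); rewrite /= setTI.
Qed.

(* Main.v *)
Require Import Defs.
From mathcomp Require Import all_boot.
From mathcomp Require Import zify.

Set Implicit Arguments.
Unset Strict Implicit.
Unset Printing Implicit Defensive.

(** If [S] is a distance-equalizer set of the corona, let [X] be the set of
    vertices of [G] whose copy of [H] lies in [S], and let [Y] consist of the
    vertices of [G] lying in [S] or not lying in [X].  Then [(X, Y)] is a pair
    admissible for [beta_star] and [|X| n(H) + |Y| <= |S|]; conversely [Y]
    together with the copies of [H] over [X] is a distance-equalizer set for
    every admissible pair.  So [xi (corona G H)] is the minimum of
    [|X| n(H) + |Y|] over admissible pairs.  Take for [k] the minimum of [|Y|]
    over the admissible pairs with [|X| = beta]; when [n(H) > m], pairs with
    [|X| > beta] are too expensive, by [|Y| >= beta] and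
    [|X| + |Y| = n(G) + |X :&: Y|]. *)

(** * Distances in a connected graph *)

Section Distance.
Variable G : sgraph.
Hypothesis Gconn : connected G.

Lemma dist_refl (x : G) : dist x x = 0.
Proof. by apply/eqP; rewrite -leqn0; apply: (@dist_min G x x [::]). Qed.

Lemma dist_eq0 (x y : G) : (dist x y == 0) = (x == y).
Proof.
apply/eqP/eqP=> [d0|->]; last exact: dist_refl.
by have [[|z p] [_ /= lp]] := dist_walk (Gconn x y); rewrite d0.
Qed.

Lemma dist_stepl (x y z : G) : adj x z -> dist x y <= (dist z y).+1.
Proof.
move=> xz; have [p [zp lp <-]] := dist_walk (Gconn z y).
by apply: (@dist_min G x y (z :: p)); rewrite //= xz.
Qed.

Lemma dist_stepr (x y z : G) : adj z y -> dist x y <= (dist x z).+1.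
Proof.
move=> zy; have [p [xp lp <-]] := dist_walk (Gconn x z).
rewrite -(size_rcons p y); apply: dist_min; last by rewrite last_rcons.
by rewrite rcons_path xp lp.
Qed.

(** Along a shortest walk [f] drops by at most one per edge. This turns a guessed distance function
    into a lower bound for [dist]. *)
Lemma lipschitz_dist (f : G -> nat) :
  (forall x y, adj x y -> f x <= (f y).+1) ->
  forall x y, f x <= f y + dist x y.
Proof.
move=> lip x y; have [p [xp <- <-]] := dist_walk (Gconn x y).
elim: p x xp => [|z p IHp] x /=; first by rewrite addn0.
case/andP=> xz zp; have := IHp z zp; have := lip _ _ xz; lia.
Qed.

End Distance.

(** * Distances in the corona product *)

Section CoronaDistance.
Variables G H : sgraph.
Hypothesis Gconn : connected G.
Let K := corona G H.

Definition base_vertex (a : G) : corona G H := inl a.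
Definition copy_vertex (a : G) (h : H) : corona G H := inr (a, h).

Lemma base_vertex_walk (a : G) p : path (@adj G) a p ->
  path (@adj K) (base_vertex a) (map base_vertex p).
Proof. by elim: p a => //= b p IHp a /andP[-> /IHp]. Qed.

Lemma base_vertex_connect (a b : G) :
  connect (@adj K) (base_vertex a) (base_vertex b).
Proof.
have [p ap ->] := connectP (Gconn a b).
apply/connectP; exists (map base_vertex p); first exact: base_vertex_walk.
by rewrite last_map.
Qed.

Lemma corona_connected : connected (corona G H).
Proof.
have toG (x : K) : exists a,
    connect (@adj K) x (base_vertex a) /\ connect (@adj K) (base_vertex a) x.
  case: x => [a|[a h]]; exists a; first by split; exact: connect0.
  by split; apply: connect1; rewrite /= eqxx.
move=> x y; have [a [xa _]] := toG x; have [b [_ yb]] := toG y.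
exact: connect_trans xa (connect_trans (base_vertex_connect a b) yb).
Qed.

Lemma dist_base_base_le (a b : G) :
  dist (base_vertex a) (base_vertex b) <= dist a b.
Proof.
have [p [ap lp <-]] := dist_walk (Gconn a b).
rewrite -(size_map base_vertex); apply: dist_min; first exact: base_vertex_walk.
by rewrite last_map lp.
Qed.

Lemma dist_base_copy_le (a b : G) h :
  dist (base_vertex a) (copy_vertex b h) <= (dist a b).+1.
Proof.
apply: leq_trans (_ : (dist (base_vertex a) (base_vertex b)).+1 <= _); last first.
  by rewrite ltnS dist_base_base_le.
by apply: (dist_stepr corona_connected); rewrite /= eqxx.
Qed.

Lemma dist_copyl_le (a : G) h (y : K) :
  dist (copy_vertex a h) y <= (dist (base_vertex a) y).+1.
Proof. by apply: (dist_stepl corona_connected); rewrite /= eqxx. Qed.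

Lemma dist_copy_copy_le (a b : G) h h' :
  dist (copy_vertex a h) (copy_vertex b h') <= (dist a b).+2.
Proof.
by apply: leq_trans (dist_copyl_le _ _ _) _; rewrite ltnS dist_base_copy_le.
Qed.

(** The left-hand side drops by at most one along each edge of the corona and vanishes at
    [base_vertex b], so [lipschitz_dist] applies. *)
Lemma dist_base_ge (x : K) (b : G) :
  match x with inl a => dist a b | inr (a, _) => (dist a b).+1 end
    <= dist x (base_vertex b).
Proof.
pose f (z : K) : nat :=
  match z with inl a => dist a b | inr (a, _) => (dist a b).+1 end.
have lip z t : @adj K z t -> f z <= (f t).+1.
  case: z t => [c|[c h]] [e|[e h']] /=; first exact: dist_stepl.
  - by move/eqP->; lia.
  - by move/eqP->.
  - by case/andP=> /eqP-> _.
by have := lipschitz_dist corona_connected lip x (base_vertex b);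
  rewrite /= dist_refl.
Qed.

(** Same argument as for base vertices. The value is 0 on the whole copy over [b], since distances
    inside one copy depend on the edges of [H]. *)
Lemma dist_copy_ge (x : K) (b : G) h :
  match x with
  | inl a => (dist a b).+1
  | inr (a, _) => if a == b then 0 else (dist a b).+2 end
    <= dist x (copy_vertex b h).
Proof.
pose f (z : K) : nat := match z with
  | inl a => (dist a b).+1
  | inr (a, _) => if a == b then 0 else (dist a b).+2 end.
have lip z t : @adj K z t -> f z <= (f t).+1.
  case: z t => [c|[c h1]] [e|[e h2]] /=.
  - by move=> ce; rewrite ltnS; apply: dist_stepl.
  - by move/eqP->; case: eqP => [->|_]; rewrite ?dist_refl; lia.
  - by move/eqP->; case: eqP => _; lia.
  - by case/andP=> /eqP-> _; lia.
by have := lipschitz_dist corona_connected lip x (copy_vertex b h);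
  rewrite /= eqxx.
Qed.

Lemma dist_base_base (a b : G) :
  dist (base_vertex a) (base_vertex b) = dist a b.
Proof.
by apply/eqP; rewrite eqn_leq dist_base_base_le (dist_base_ge (base_vertex a)).
Qed.

Lemma dist_base_copy (a b : G) h :
  dist (base_vertex a) (copy_vertex b h) = (dist a b).+1.
Proof.
by apply/eqP; rewrite eqn_leq dist_base_copy_le (dist_copy_ge (base_vertex a)).
Qed.

Lemma dist_copy_base (a b : G) h :
  dist (copy_vertex a h) (base_vertex b) = (dist a b).+1.
Proof.
apply/eqP; rewrite eqn_leq (dist_base_ge (copy_vertex a h)) andbT.
by rewrite -(dist_base_base a b) dist_copyl_le.
Qed.

Lemma dist_copy_copy (a b : G) h h' : a != b ->
  dist (copy_vertex a h) (copy_vertex b h') = (dist a b).+2.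
Proof.
move=> ab; apply/eqP; rewrite eqn_leq dist_copy_copy_le.
by have := dist_copy_ge (copy_vertex a h) b h'; rewrite /= (negPf ab).
Qed.

End CoronaDistance.

(** * Covers, admissible pairs and equalizer sets: logical forms and extremal bounds *)

Lemma vertex_coverP (G : sgraph) (S : {set G}) :
  reflect (forall u v, adj u v -> u \notin S -> v \in S) (vertex_cover S).
Proof.
apply: (iffP forallP) => [cov u v uv /negPf uS|cov u].
  by have /forallP/(_ v)/implyP/(_ uv) := cov u; rewrite uS.
apply/forallP=> v; apply/implyP=> uv.
by case: (boolP (u \in S)) => //= /(cov _ _ uv).
Qed.

Lemma independent_coverC (G : sgraph) (S : {set G}) :
  independent S = vertex_cover (~: S).
Proof.
apply/idP/vertex_coverP=> [ind u v uv|cov].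
  rewrite !inE negbK => uS; apply/negP=> vS.
  by have := forall_inP (forall_inP ind u uS) v vS; rewrite uv.
apply/forall_inP=> u uS; apply/forall_inP=> v vS; apply/negP=> uv.
by have := cov u v uv; rewrite !inE vS uS; move/(_ isT).
Qed.

Lemma beta_le (G : sgraph) (S : {set G}) : vertex_cover S -> beta G <= #|S|.
Proof.
by rewrite /beta; case: arg_minnP => [|T _ minT /minT//]; apply: vertex_coverT.
Qed.

Lemma beta_ex (G : sgraph) : exists2 S : {set G}, vertex_cover S & #|S| = beta G.
Proof.
by rewrite /beta; case: arg_minnP => [|T covT _]; [apply: vertex_coverT|exists T].
Qed.

(** Gallai's identity: complementation exchanges independent sets and vertex covers. *)
Lemma alpha_beta (G : sgraph) : alpha G + beta G = graph_order G.
Proof.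
have [S covS cardS] := beta_ex G.
apply/eqP; rewrite eqn_leq; apply/andP; split.
  suff: alpha G <= graph_order G - beta G.
    by have := max_card (mem S); rewrite cardS /graph_order; lia.
  apply/bigmax_leqP=> T; rewrite independent_coverC => /beta_le.
  by have := cardsC T; rewrite /graph_order; lia.
suff: #|~: S| <= alpha G by have := cardsC S; rewrite /graph_order; lia.
by apply: leq_bigmax_cond; rewrite independent_coverC setCK.
Qed.

Lemma beta_star_le (G : sgraph) (XY : {set G} * {set G}) :
  beta_star_pair XY -> beta_star G <= #|XY.1 :&: XY.2|.
Proof.
rewrite /beta_star; case: arg_minnP => [|Z _ minZ /minZ//].
by apply: beta_star_pairT; apply: vertex_coverT.
Qed.

Lemma equalizer_setP (G : sgraph) (S : {set G}) :
  reflect (forall u v, u != v -> u \notin S -> v \notin S ->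
             exists2 w, w \in S & dist w u = dist w v)
          (equalizer_set S).
Proof.
apply: (iffP forallP) => [eqS u v uv uS vS|eqS u].
  have /forallP/(_ v)/implyP := eqS u; rewrite uv uS vS => /(_ isT).
  by case/exists_inP=> w wS /eqP; exists w.
apply/forallP=> v; apply/implyP=> /and3P[uv uS vS].
by have [w wS dw] := eqS u v uv uS vS; apply/exists_inP; exists w; rewrite ?dw.
Qed.

Lemma xi_le (G : sgraph) (S : {set G}) : equalizer_set S -> xi G <= #|S|.
Proof.
by rewrite /xi; case: arg_minnP => [|T _ minT /minT//]; apply: equalizer_setT.
Qed.

Lemma xi_ex (G : sgraph) : exists2 S : {set G}, equalizer_set S & #|S| = xi G.
Proof.
by rewrite /xi; case: arg_minnP => [|T eqT _]; [apply: equalizer_setT|exists T].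
Qed.

Lemma ebis_coverP (G : sgraph) (S : {set G}) :
  reflect (forall u v, u != v -> u \notin S -> v \notin S ->
             exists w, dist w u = dist w v)
          (@vertex_cover (empty_bisector_graph G) S).
Proof.
apply: (iffP (@vertex_coverP (empty_bisector_graph G) S)) => cov u v.
  move=> uv uS vS; case: (boolP [exists w : G, dist w u == dist w v]).
    by case/existsP=> w /eqP; exists w.
  by move=> nw; have := cov u v; rewrite /= /ebis_adj uv nw (negPf vS) => /(_ isT uS).
rewrite /= /ebis_adj => /andP[uv /existsPn nw] uS.
apply: contraT => vS; have [w /eqP] := cov u v uv uS vS.
by rewrite (negPf (nw w)).
Qed.

(** As [X] and [Y] cover the graph, a vertex outside one of them lies in the other, so the set
    differences reduce to non-membership. *)
Lemma forward_equalizedP (G : sgraph) (X Y : {set G}) :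
  reflect (X :|: Y = [set: G] /\
           forall u v, u \notin Y -> v \notin X -> exists w, dist w u = (dist w v).+1)
          (forward_equalized X Y).
Proof.
apply: (iffP andP) => [[/eqP XY fwd]|[XY fwd]]; split=> //.
- move=> u v uY vX.
  have uX : u \in X by have := in_setT u; rewrite -XY inE (negPf uY) orbF.
  have vY : v \in Y by have := in_setT v; rewrite -XY inE (negPf vX).
  have := forall_inP fwd u; rewrite inE uY uX => /(_ isT)/forall_inP/(_ v).
  rewrite inE vX vY => /(_ isT)/existsP[w /eqP dw].
  by exists w; rewrite dw addn1.
- exact/eqP.
- apply/forall_inP=> u; rewrite inE => /andP[uY _].
  apply/forall_inP=> v; rewrite inE => /andP[vX _].
  by have [w dw] := fwd u v uY vX; apply/existsP; exists w; rewrite dw addn1.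
Qed.

(** * Equalizer sets of the corona versus admissible pairs *)

Section CoronaEqualizer.
Variables G H : sgraph.
Hypothesis Gconn : connected G.
Let base_vertex := @base_vertex G H.
Let copy_vertex := @copy_vertex G H.

Definition pair_set (X Y : {set G}) : {set corona G H} :=
  [set x : corona G H | match x with inl a => a \in Y | inr (a, _) => a \in X end].

Lemma base_in_pair_set X Y a : (base_vertex a \in pair_set X Y) = (a \in Y).
Proof. by rewrite inE. Qed.

Lemma copy_in_pair_set X Y a h : (copy_vertex a h \in pair_set X Y) = (a \in X).
Proof. by rewrite inE. Qed.

Lemma card_corona_set (S : {set corona G H}) :
  #|S| = #|[set a | base_vertex a \in S]|
         + \sum_(a : G) #|[set h | copy_vertex a h \in S]|.
Proof.
rewrite -sum1_card big_mkcond big_sumType /=; congr (_ + _).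
  by rewrite -sum1_card [RHS]big_mkcond /=; apply: eq_bigr => a _; rewrite inE.
transitivity (\sum_(a : G) \sum_(h : H) (if copy_vertex a h \in S then 1 else 0)).
  by rewrite pair_bigA; apply: eq_bigr => -[a h].
apply: eq_bigr => a _; rewrite -sum1_card [RHS]big_mkcond /=.
by apply: eq_bigr => h _; rewrite inE.
Qed.

Lemma card_pair_set (X Y : {set G}) :
  #|pair_set X Y| = #|X| * graph_order H + #|Y|.
Proof.
rewrite card_corona_set addnC; congr (_ + _); last first.
  by apply: eq_card => a; rewrite inE base_in_pair_set.
rewrite -sum_nat_const [RHS]big_mkcond /=; apply: eq_bigr => a _.
case: ifPn => aX.
  by apply: eq_card => h; rewrite inE copy_in_pair_set aX.
by apply/eqP; rewrite cards_eq0; apply/eqP/setP=> h; rewrite inE copy_in_pair_set (negPf aX) inE.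
Qed.

(** A vertex [c] of [G] supplied by admissibility is represented in [pair_set X Y] by itself if it
    lies in [Y], and otherwise by a vertex of its copy. Passing to the copy adds one to both
    distances compared, as long as neither target lies in that copy. *)
Lemma pair_set_equalizer (X Y : {set G}) :
  beta_star_pair (X, Y) -> equalizer_set (pair_set X Y).
Proof.
case/and3P=> /= /ebis_coverP covX /ebis_coverP covY /forward_equalizedP[XY fwd].
have [h0 _] := card_gt0P (vertex_gt0 H).
have inXY c : (c \in Y) || (c \in X) by have := in_setT c; rewrite -XY inE orbC.
(* The extra edge from [b] into its copy is what the [+ 1] of a forward-equalized pair
   compensates. *)
have mixed a b h : a \notin Y -> b \notin X ->
    exists2 w, w \in pair_set X Y & dist w (base_vertex a) = dist w (copy_vertex b h).
  move=> aY bX; have [c dc] := fwd a b aY bX.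
  have [cY|cX] := orP (inXY c).
    by exists (base_vertex c); rewrite ?base_in_pair_set ?copy_in_pair_set // dist_base_base // dist_base_copy.
  have cb : c != b by apply: contraNneq bX => <-.
  exists (copy_vertex c h0); first by rewrite copy_in_pair_set.
  by rewrite dist_copy_base // dist_copy_copy // dc.
apply/equalizer_setP=> [] [a|[a h]] [b|[b h']] uv; rewrite !inE => uS vS.
- have ab : a != b by apply: contraNneq uv => ->.
  have [c dc] := covY a b ab uS vS.
  have [cY|cX] := orP (inXY c).
    by exists (base_vertex c); rewrite ?base_in_pair_set ?copy_in_pair_set // !dist_base_base.
  by exists (copy_vertex c h0); rewrite ?base_in_pair_set ?copy_in_pair_set // !dist_copy_base // dc.
- exact: mixed.
- by have [w wS dw] := mixed b a h vS uS; exists w.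
- have [ab|ab] := eqVneq a b.
    (* Two vertices of the same copy are both at distance 1 from its base vertex. *)
    subst b; have aY : a \in Y by have := inXY a; rewrite (negPf uS) orbF.
    by exists (base_vertex a); rewrite ?base_in_pair_set ?copy_in_pair_set // !dist_base_copy.
  have [c dc] := covX a b ab uS vS.
  have [cY|cX] := orP (inXY c).
    by exists (base_vertex c); rewrite ?base_in_pair_set ?copy_in_pair_set // !dist_base_copy // dc.
  exists (copy_vertex c h0); first by rewrite copy_in_pair_set.
  rewrite !dist_copy_copy // ?dc //.
    by apply: contraNneq vS => <-.
  by apply: contraNneq uS => <-.
Qed.

(** The size bound holds because a base vertex that is added to [Y] without lying in [S] is paid for
    by a vertex of [S] in its own, incomplete copy. *)
Lemma equalizer_pair (S : {set corona G H}) : equalizer_set S ->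
  exists X Y : {set G}, beta_star_pair (X, Y) /\ #|X| * graph_order H + #|Y| <= #|S|.
Proof.
move/equalizer_setP=> eqS.
pose X := [set a | [forall h, copy_vertex a h \in S]].
pose A := [set a | base_vertex a \in S].
have notX a : a \notin X -> exists h, copy_vertex a h \notin S.
  by rewrite inE => /forallPn.
have inj a b h h' : a != b -> copy_vertex a h != copy_vertex b h'.
  by apply: contra_neq => -[].
exists X, (A :|: ~: X); split; last first.
  rewrite -card_pair_set !card_corona_set.
  set B := [set a | _ \in pair_set _ _].
  have ->: #|B| = #|A| + #|~: X :\: A|.
    rewrite -[LHS](cardsID A); congr (_ + _); apply: eq_card => a;
      rewrite ?in_setI ?in_setD [a \in B]inE base_in_pair_set in_setU;
      by case: (a \in A); rewrite ?andbF.
  (* What remains is compared one copy at a time. *)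
  rewrite -addnA leq_add2l -sum1_card big_mkcond -big_split /=.
  apply: leq_sum => a _; case: (boolP (a \in X)) => aX.
    rewrite in_setD in_setC aX andbF add0n; apply: subset_leq_card.
    by apply/subsetP=> h _; rewrite inE; move: aX; rewrite inE => /forallP.
  have ->: #|[set h | copy_vertex a h \in pair_set X (A :|: ~: X)]| = 0.
    apply/eqP; rewrite cards_eq0; apply/eqP/setP=> h.
    by rewrite inE copy_in_pair_set (negPf aX) inE.
  rewrite addn0 in_setD in_setC aX andbT; case: ifP => // aA.
  have [h hS] := notX a aX.
  have aS : base_vertex a \notin S by move: aA; rewrite inE => ->.
  (* From outside the copy over [a], the vertex [copy_vertex a h] is one step farther than [a], so
     the equalizing vertex lies inside that copy. *)
  have [//|[c|[c h1]] wS] := eqS (base_vertex a) (copy_vertex a h) _ aS hS.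
    by rewrite dist_base_base // dist_base_copy //; lia.
  have [ca|ca] := eqVneq c a; last first.
    by rewrite dist_copy_base // dist_copy_copy //; lia.
  by move=> _; apply/card_gt0P; exists h1; rewrite inE -ca.
apply/and3P; split=> /=.
- apply/ebis_coverP=> a b ab /notX[h hS] /notX[h' h'S].
  have [[c|[c h1]] wS] := eqS _ _ (inj _ _ h h' ab) hS h'S.
    by rewrite !dist_base_copy // => -[]; exists c.
  (* A vertex in the copy of one target is at distance at most 2 from that target and at least 3
     from the other, so it equalizes nothing here. *)
  have [ca|ca] := eqVneq c a.
    subst c; rewrite [RHS]dist_copy_copy // => dw.
    have := dist_copy_copy_le Gconn a a h1 h; rewrite dw dist_refl.
    by have := dist_eq0 Gconn a b; rewrite (negPf ab); lia.
  have [cb|cb] := eqVneq c b.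
    subst c; rewrite dist_copy_copy // => dw.
    have := dist_copy_copy_le Gconn b b h1 h'; rewrite -dw dist_refl.
    by have := dist_eq0 Gconn b a; rewrite (negPf ca); lia.
  by rewrite !dist_copy_copy // => -[]; exists c.
- apply/ebis_coverP=> a b ab; rewrite !in_setU !negb_or => /andP[aA _] /andP[bA _].
  rewrite !inE in aA bA.
  have ab' : base_vertex a != base_vertex b by apply: contra_neq ab => -[].
  have [[c|[c h1]] wS] := eqS _ _ ab' aA bA.
    by rewrite !dist_base_base //; exists c.
  by rewrite !dist_copy_base // => -[]; exists c.
apply/forward_equalizedP; split.
  by apply/setP=> a; rewrite !in_setU in_setC in_setT orbCA orbN orbT.
move=> a b; rewrite in_setU in_setC negb_or negbK => /andP[aA aX] bX.
have [h hS] := notX b bX; rewrite inE in aA.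
have ab : b != a by apply: contraNneq bX => ->.
have [//|[c|[c h1]] wS] := eqS (base_vertex a) (copy_vertex b h) _ aA hS.
  by rewrite dist_base_base // dist_base_copy //; exists c.
have [cb|cb] := eqVneq c b; last first.
  by rewrite dist_copy_base // dist_copy_copy // => -[]; exists c.
(* Distances inside the copy over [b] are at most 2, which forces [dist b a = 1]; then [b] itself is
   the required vertex. *)
subst c; rewrite dist_copy_base // => dw.
have := dist_copy_copy_le Gconn b b h1 h; rewrite -dw dist_refl.
have := dist_eq0 Gconn b a; rewrite (negPf ab) => db; exists b.
by rewrite dist_refl; lia.
Qed.

End CoronaEqualizer.

(** * Choice of [k] and optimality for large [H] *)

Theorem theorem31 (G : sgraph) (hG : connected G) :
  let Ghat := empty_bisector_graph G in
  let m := minn (alpha Ghat) (beta Ghat - beta_star G + 1) in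
  exists k : nat,
    [/\ alpha Ghat + beta_star G <= k,
        k <= graph_order G,
        forall H : sgraph, m < graph_order H ->
          xi (corona G H) = beta Ghat * graph_order H + k
      & forall H : sgraph, graph_order H <= m ->
          xi (corona G H) <= beta Ghat * graph_order H + k].
Proof.
move=> Ghat m.
have gallai : alpha Ghat + beta Ghat = #|G| := alpha_beta Ghat.
have cardXY (X Y : {set G}) : beta_star_pair (X, Y) ->
    [/\ beta Ghat <= #|X|, beta Ghat <= #|Y|
      & #|G| + beta_star G <= #|X| + #|Y| ].
  move=> adm; have := beta_star_le adm; case/and3P: adm => /= covX covY.
  case/forward_equalizedP=> XY _ starXY.
  split; [exact: (@beta_le Ghat)|exact: (@beta_le Ghat)|].
  by rewrite -cardsUI XY cardsT leq_add2l.
have [X0 covX0 cardX0] := beta_ex Ghat.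
pose P (XY : {set G} * {set G}) := beta_star_pair XY && (#|XY.1| == beta Ghat).
(* A minimum cover paired with the full vertex set is admissible, so the minimum defining [k]
   exists. *)
have P0 : P (X0, [set: G]).
  rewrite /P /= cardX0 eqxx andbT; apply/and3P; split=> //=.
    exact: (@vertex_coverT Ghat).
  by apply/forward_equalizedP; split=> [|u v]; rewrite ?setUT ?inE.
case: (arg_minnP (fun XY : {set G} * {set G} => #|XY.2|) P0) => -[X1 Y1].
rewrite {1}/P /= => /andP[adm1 /eqP cardX1] min1.
have xi_upper (H : sgraph) : xi (corona G H) <= beta Ghat * graph_order H + #|Y1|.
  rewrite -cardX1 -card_pair_set.
  by apply: xi_le; apply: pair_set_equalizer.
have leY1 : #|Y1| <= #|G| := max_card (mem Y1).
exists #|Y1|; split=> //.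
  (* Replacing the order of [G] by [alpha Ghat + beta Ghat] in the sum bound and cancelling
     [beta Ghat] gives the lower bound on [k]. *)
  by have [_ _] := cardXY _ _ adm1; rewrite cardX1; lia.
move=> H lt_m; apply/eqP; rewrite eqn_leq xi_upper /=.
have [S eqS <-] := xi_ex (corona G H).
have [X [Y [adm leS]]] := equalizer_pair hG eqS.
apply: leq_trans leS; have [geX geY geXY] := cardXY X Y adm.
have [eX|ltX] := eqVneq #|X| (beta Ghat).
  by rewrite eX leq_add2l; apply: (min1 (X, Y)); rewrite /P adm /= eX eqxx.
have := beta_star_le_beta G; rewrite -/Ghat => star_beta.
(* The [j.+1] surplus copies must be shown to cost enough, with [#|Y|], to reach [#|Y1|], which is
   at most [#|G|]. *)
have [j eX] : exists j, #|X| = beta Ghat + j.+1.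
  by exists (#|X| - beta Ghat).-1; lia.
have le_jn : j <= j * graph_order H by rewrite leq_pmulr //; apply: vertex_gt0.
rewrite eX mulnDl -addnA leq_add2l mulSn.
(* If [graph_order H] exceeds [alpha Ghat], one surplus copy and [geY] already exceed [#|G|]. If it
   exceeds the other term of [m], [geXY] bounds [#|Y|] from below, and [le_jn] absorbs the loss of
   [j] in that bound. *)
by move: lt_m; rewrite /m gtn_min; case/orP; lia.
Qed.
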